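(* Let $p$ be a prime and let $(X,G_\bullet)$ be a graph of finite $p$-groups (with $X$ a connected, possibly infinite, graph) with fundamental group $G=\pi_1(X,G_\bullet)$. Suppose that there is a chief series $(G_x^{(k)})_{k\geq 0}$ of $G_x$ for each $x\in X=VX\sqcup EX$, with $G_y^{(k)}=G_{\bar y}^{(k)}$ for all $y\in EX$ and $k\ge 0$, such that the following two properties hold. (I) For all integers $k\ge 0$ and all $y\in EX$, we have $f_y(G^{(k)}_y) = f_y(G_y) \cap G^{(k)}_{t(y)}$. (II) For each integer $k\ge 0$ there exists a family of injective group homomorphisms $\phi^{(k)}_x\colon \gamma^{(k)}(G_x)\hookrightarrow \mathbb{F}_p$ (for $x\in X$), with $\phi^{(k)}_y=\phi^{(k)}_{\bar y}$ for all $y\in EX$, such that for all $y\in EX$ $$\phi^{(k)}_{t(y)}\circ \overline{f}_y^{(k)} = \phi^{(k)}_y,$$ where $\overline{f}_y^{(k)}\colon \gamma^{(k)}(G_y)\to\gamma^{(k)}(G_{t(y)})$ is the homomorphism induced by $f_y$ (well defined by (I)). Then $G$ is residually $p$-finite.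
   Context: **Residually $p$-finite.** A group $G$ is residually $p$-finite if for every $g\in G\smallsetminus\{1\}$ there exists a homomorphism from $G$ to a finite $p$-group whose kernel does not contain $g$. No finite generation is assumed. **Graphs (in the sense of Serre).** A graph $X=VX\sqcup EX$ consists of a set $VX$ of vertices and a set $EX$ of edges. Each edge $y$ has an opposite edge $\bar y\neq y$ and endpoints $o(y),t(y)\in VX$, with $o(\bar y)=t(y)$ and $\bar{\bar y}=y$. Graphs may be infinite. **Graphs of groups.** A graph of groups $(X,G_\bullet)$ consists of a connected graph $X$; a group $G_x$ for each $x\in VX\cup EX$, with $G_y=G_{\bar y}$ for $y\in EX$ (the same group); and monomorphisms $f_y\colon G_y\hookrightarrow G_{t(y)}$ for all $y\in EX$. It is a graph of finite $p$-groups if every $G_x$ ($x\in VX\cup EX$) is a finite $p$-group. **Fundamental group.** Fix a maximal subtree $T$ of $X$ and an orientation $E^{+}X\subseteq EX$, i.e. a subset containing exactly one of $y,\bar y$ for every $y\in EX$. Put $\epsilon(y)=0$ if $y\in E^{+}X$ and $\epsilon(y)=1$ otherwise. Then $\pi_1(X,G_\bullet)$ is the group obtained from the free product of the groups $G_x$ ($x\in VX\cup EX$, with $G_y=G_{\bar y}$ the same copy) and the free group on letters $s_y$ ($y\in EX$), subject to the relations: $g=s_y^{1-\epsilon(y)}f_y(g)s_y^{\epsilon(y)-1}$ for $y\in EX$ and $g\in G_y$; $s_y=1$ for all $y\in ET$; and $s_{\bar y}=s_y$ for all $y\in EX$. **Chief series.** A chief series for a finite $p$-group $P$ is an infinite sequence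 $P=P^{(0)}\geq P^{(1)}\geq\cdots\geq P^{(k)}\geq\cdots$ of normal subgroups of $P$ such that each successive quotient $\gamma^{(k)}(P)=P^{(k)}/P^{(k+1)}$ is either trivial or of order $p$, and such that $P^{(n)}=1$ for some $n$. The lengths of the chief series of the different $G_x$ are not assumed to be bounded. $\mathbb{F}_p$ denotes the field with $p$ elements, regarded as an additive group. *)

(* Defs.v *)
From HB Require Import structures.
From mathcomp Require Import all_boot all_fingroup all_algebra all_solvable.
From mathcomp Require Import boolp classical_sets.

Set Implicit Arguments.
Unset Strict Implicit.
Unset Printing Implicit Defensive.

Import GroupScope.
Local Open Scope quotient_scope.

(* [(s, false)] stands for the generator [s] and [(s, true)] for its inverse. *)
Definition word (S : choiceType) := seq (S * bool).

(* [repr] is shadowed by the choice function of fingroup. *)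
Local Notation qrepr := generic_quotient.repr.

Section Presented.
Context {S : choiceType}.
Implicit Types u v w : word S.

Inductive word_cong (R : word S -> word S -> Prop) : word S -> word S -> Prop :=
| cong_refl u : word_cong R u u
| cong_sym u v : word_cong R u v -> word_cong R v u
| cong_trans v u w : word_cong R u v -> word_cong R v w -> word_cong R u w
| cong_cat u u' v v' :
    word_cong R u u' -> word_cong R v v' -> word_cong R (u ++ v) (u' ++ v')
| cong_cancel s b : word_cong R [:: (s, b); (s, ~~ b)] [::]
| cong_rel u v : R u v -> word_cong R u v.

Variable R : word S -> word S -> Prop.

Definition word_congb : rel (word S) := fun u v => `[< word_cong R u v >].

Fact word_congb_equiv : equiv_class_of word_congb.
Proof.
split.
- by move=> u; apply/asboolP; apply: cong_refl.
- by move=> u v; apply/asboolP/asboolP; apply: cong_sym.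
- move=> v u w /asboolP uv /asboolP vw.
  by apply/asboolP; apply: cong_trans vw.
Qed.

Canonical word_congb_equiv_rel := EquivRelPack word_congb_equiv.

(* The group with generators [S] and relations [u = v] for all [R u v]. *)
Definition presented := {eq_quot word_congb}.

HB.instance Definition _ := Choice.on presented.
HB.instance Definition _ := Quotient.on presented.

Definition winv u : word S := rev [seq (x.1, ~~ x.2) | x <- u].

Definition pres_class u : presented := \pi_presented u.
Definition pres_one : presented := pres_class [::].
Definition pres_mul (x y : presented) : presented := pres_class (qrepr x ++ qrepr y).
Definition pres_inv (x : presented) : presented := pres_class (winv (qrepr x)).

Lemma pres_classP u v : pres_class u = pres_class v <-> word_cong R u v.
Proof.
by split=> [/eqmodP/asboolP //|uv]; apply/eqmodP/asboolP.
Qed.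

Lemma repr_class u : word_cong R (qrepr (pres_class u)) u.
Proof. by apply/pres_classP; rewrite /pres_class reprK. Qed.

Lemma pres_mulE u v :
  pres_mul (pres_class u) (pres_class v) = pres_class (u ++ v).
Proof. by apply/pres_classP/cong_cat; apply: repr_class. Qed.

Lemma winvK : involutive winv.
Proof.
move=> u; rewrite /winv map_rev revK -map_comp -[RHS]map_id.
by apply: eq_map => -[s b] /=; rewrite negbK.
Qed.

Lemma cong_winv u v : word_cong R u v -> word_cong R (u ++ winv v) [::].
Proof.
move=> uv; apply: (cong_trans (v := v ++ winv v)).
  by apply: cong_cat => //; apply: cong_refl.
elim: v {uv} => [|[s b] v IHv]; first exact: cong_refl.
have ->: ((s, b) :: v) ++ winv ((s, b) :: v)
    = [:: (s, b)] ++ (v ++ winv v) ++ [:: (s, ~~ b)].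
  by rewrite /winv /= rev_cons -cats1 catA.
apply: (cong_trans (v := [:: (s, b)] ++ [::] ++ [:: (s, ~~ b)])).
  apply: cong_cat; first exact: cong_refl.
  by apply: cong_cat => //; apply: cong_refl.
exact: cong_cancel.
Qed.

Lemma pres_classK x : pres_class (qrepr x) = x.
Proof. exact: reprK. Qed.

Fact pres_mulA : associative pres_mul.
Proof.
move=> x y z; rewrite -(pres_classK x) -(pres_classK y) -(pres_classK z).
by rewrite !pres_mulE catA.
Qed.

Fact pres_mul1 : left_id pres_one pres_mul.
Proof. by move=> x; rewrite -(pres_classK x) pres_mulE. Qed.

Fact pres_mulr1 : right_id pres_one pres_mul.
Proof. by move=> x; rewrite -(pres_classK x) pres_mulE cats0. Qed.

Fact pres_mulV : left_inverse pres_one pres_inv pres_mul.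
Proof.
move=> x; rewrite -{2}(pres_classK x) pres_mulE; apply/pres_classP.
by rewrite -{2}[qrepr x]winvK; apply/cong_winv/cong_refl.
Qed.

Fact pres_mulrV : right_inverse pres_one pres_inv pres_mul.
Proof.
move=> x; rewrite -{1}(pres_classK x) pres_mulE; apply/pres_classP.
exact/cong_winv/cong_refl.
Qed.

HB.instance Definition _ := isGroup.Build presented
  pres_mulA pres_mul1 pres_mulr1 pres_mulV pres_mulrV.

End Presented.

Arguments presented {S} R.

Definition residually_p_finite (p : nat) (G : groupType) : Prop :=
  forall g : G, g <> 1 ->
    exists (P : finGroupType) (f : {multiplicative G -> P}),
      p.-group [set: P] /\ f g <> 1.

(* A graph in the sense of Serre, possibly infinite. *)
Record graph := Graph {
  vert : choiceType;
  edge : choiceType;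
  opp : edge -> edge;
  org : edge -> vert;
  tgt : edge -> vert;
  opp_neq : forall y, opp y <> y;
  oppK : forall y, opp (opp y) = y;
  org_opp : forall y, org (opp y) = tgt y
}.

Section Graphs.
Variable X : graph.
Implicit Types (y z : edge X) (s : seq (edge X)).

Fixpoint walk (u : vert X) (s : seq (edge X)) (v : vert X) : Prop :=
  if s is y :: s' then org y = u /\ walk (tgt y) s' v else u = v.

Definition graph_connected : Prop := forall u v : vert X, exists s, walk u s v.

Definition same_uedge : rel (edge X) := fun y z => (z == y) || (z == opp y).

Fact same_uedge_equiv : equiv_class_of same_uedge.
Proof.
have sym y z : same_uedge y z -> same_uedge z y.
  by case/orP=> /eqP->; rewrite /same_uedge ?oppK eqxx ?orbT.
split.
- by move=> y; rewrite /same_uedge eqxx.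
- by move=> y z; apply/idP/idP; apply: sym.
- move=> y x z /orP[]/eqP-> /orP[]/eqP->;
    by rewrite /same_uedge ?oppK eqxx ?orbT.
Qed.

Canonical same_uedge_equiv_rel := EquivRelPack same_uedge_equiv.

(* The geometric edges, i.e. the pairs {y, opp y}. *)
Definition uedge := {eq_quot same_uedge}.
HB.instance Definition _ := Choice.on uedge.
HB.instance Definition _ := Quotient.on uedge.

Definition to_uedge y : uedge := \pi_uedge y.

Lemma to_uedge_opp y : to_uedge (opp y) = to_uedge y.
Proof. by apply/eqmodP; rewrite /= /same_uedge oppK eqxx orbT. Qed.

Record subgraph := Subgraph {
  sub_vert : set (vert X);
  sub_edge : set (edge X);
  sub_opp : forall y, sub_edge y -> sub_edge (opp y);
  sub_tgt : forall y, sub_edge y -> sub_vert (tgt y)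
}.

(* A circuit is the image of an injective map from a cyclic graph with
   [size s >= 1] vertices; loops (size 1) and pairs of parallel edges (size 2)
   are included. *)
Definition circuit s : Prop :=
  [/\ s <> [::], exists v, walk v s v,
      sorted (fun y z => z != opp y) s & uniq [seq tgt y | y <- s]].

Definition is_subtree (T : subgraph) : Prop :=
  [/\ exists v, sub_vert T v,
      forall u v, sub_vert T u -> sub_vert T v ->
        exists2 s, walk u s v & {in s, forall y, sub_edge T y}
    & forall s, {in s, forall y, sub_edge T y} -> ~ circuit s].

Definition is_maximal_subtree (T : subgraph) : Prop :=
  is_subtree T /\
  forall T' : subgraph, is_subtree T' ->
    (sub_vert T `<=` sub_vert T')%classic ->
    (sub_edge T `<=` sub_edge T')%classic ->
    (sub_vert T' `<=` sub_vert T)%classic /\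
    (sub_edge T' `<=` sub_edge T)%classic.

Definition is_orientation (Eplus : set (edge X)) : Prop :=
  forall y, (Eplus y /\ ~ Eplus (opp y)) \/ (~ Eplus y /\ Eplus (opp y)).

Definition epsilon (Eplus : set (edge X)) y : nat :=
  if `[< Eplus y >] then 0%N else 1%N.

End Graphs.

(* Edge groups are indexed by geometric edges, so that the groups of [y] and
   [opp y] are the same group. *)
Record graph_of_fingroups (X : graph) := GraphOfFinGroups {
  vgrp : vert X -> finGroupType;
  egrp : uedge X -> finGroupType;
  emor : forall y : edge X,
    {morphism [set: egrp (to_uedge y)] >-> vgrp (tgt y)};
  emor_inj : forall y, 'injm (emor y)
}.

Section FundamentalGroup.
Variables (X : graph) (G : graph_of_fingroups X).

Definition graph_of_pgroups (p : nat) : Prop :=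
  (forall v, p.-group [set: vgrp G v]) /\ (forall e, p.-group [set: egrp G e]).

Definition pi1_gen : choiceType :=
  ({v : vert X & vgrp G v} + {e : uedge X & egrp G e} + edge X)%type.

Definition vlet (v : vert X) (g : vgrp G v) : pi1_gen * bool :=
  (inl (inl (Tagged (vgrp G) g)), false).
Definition elet (e : uedge X) (g : egrp G e) : pi1_gen * bool :=
  (inl (inr (Tagged (egrp G) g)), false).
Definition stab (y : edge X) : pi1_gen * bool := (inr y, false).
Definition stabV (y : edge X) : pi1_gen * bool := (inr y, true).

(* The first two clauses are the multiplication tables of the vertex and edge
   groups: together with the free letters they present the free product. Since
   [1 - epsilon y >= 0], the power [s_y ^ (1 - epsilon y)] is the repeated
   letter [stab y], and [s_y ^ (epsilon y - 1)] the repeated [stabV y]. *)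
Inductive pi1_rel (T : subgraph X) (Eplus : set (edge X)) :
    word pi1_gen -> word pi1_gen -> Prop :=
| pi1_vmul v (g h : vgrp G v) :
    pi1_rel T Eplus [:: vlet g; vlet h] [:: vlet (g * h)]
| pi1_emul e (g h : egrp G e) :
    pi1_rel T Eplus [:: elet g; elet h] [:: elet (g * h)]
| pi1_edge y (g : egrp G (to_uedge y)) :
    pi1_rel T Eplus [:: elet g]
      (nseq (1 - epsilon Eplus y) (stab y) ++ [:: vlet (emor G y g)]
         ++ nseq (1 - epsilon Eplus y) (stabV y))
| pi1_tree y : sub_edge T y -> pi1_rel T Eplus [:: stab y] [::]
| pi1_opp y : pi1_rel T Eplus [:: stab (opp y)] [:: stab y].

Definition pi1 (T : subgraph X) (Eplus : set (edge X)) : groupType :=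
  presented (pi1_rel T Eplus).

End FundamentalGroup.

Definition chief_series (p : nat) (gT : finGroupType)
    (C : nat -> {group gT}) : Prop :=
  [/\ C 0%N :=: [set: gT],
      forall k, C k.+1 \subset C k,
      forall k, C k <| [set: gT],
      forall k, #|C k / C k.+1| = 1%N \/ #|C k / C k.+1| = p
    & exists n, C n :=: 1].

(* The map H' / H -> K' / K induced by [f] when [f] maps H' to K' and H to K. *)
Definition induced (aT rT : finGroupType) (f : aT -> rT)
    (H : {group aT}) (K : {group rT}) (x : coset_of H) : coset_of K :=
  coset K (f (repr x)).

Lemma inducedE (aT rT : finGroupType) (f : {morphism [set: aT] >-> rT})
    (H : {group aT}) (K : {group rT}) (g : aT) :
    H <| [set: aT] -> K <| [set: rT] -> f @* H \subset K ->
  induced f K (coset H g) = coset K (f g).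
Proof.
move=> /andP[_ nH] /andP[_ nK] fHK.
have inN x : x \in 'N(H) by rewrite (fintype.subsetP nH) ?inE.
have inK x : x \in 'N(K) by rewrite (fintype.subsetP nK) ?inE.
have: repr (coset H g) \in coset H g by apply: mem_repr_coset.
rewrite {2}val_coset // => /rcosetP[h Hh E]; rewrite /induced E morphM ?inE // coset_kerl // (fintype.subsetP fHK) //.
by apply: mem_morphim; rewrite ?inE.
Qed.

(* Main.v *)
Require Import Defs.
From HB Require Import structures.
From mathcomp Require Import all_boot all_fingroup all_algebra all_solvable.
From mathcomp Require Import boolp classical_sets.

Set Implicit Arguments.
Unset Strict Implicit.
Unset Printing Implicit Defensive.

(* In the sequel [opp] is edge reversal. *)
Import Defs.
Import GroupScope.

(** The proof builds finite quotients by hand, as iterated wreath products with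
    F_p, and never looks at the Bass-Serre tree.

    A representation of the graph of groups [G] in a group [Q] ([rep]) consists
    of homomorphisms [G_v -> Q] and of an element of [Q] for every edge [y]
    that conjugates the two images of [G_y] into each other; reversal of the
    edge inverts the element. Representations that are trivial on the edges of
    the maximal subtree are homomorphisms out of [pi1] ([pi1_lift]), and
    conversely the letters of [pi1] form a representation in [pi1] itself
    ([pi1_rep]). Since closed walks in a tree have trivial value
    ([closed_walk_val1]), every representation can be made trivial on the tree
    by conjugating the vertex groups ([tree_potential], [gauge]), which does
    not affect the values of closed walks up to conjugacy. So it is enough to
    find a representation in a finite p-group that does not kill a given
    element of [pi1], and this element can be written as a closed path
    [g0 y1 g1 ... ym gm] which is reduced: no backtracking [y g opp y] with
    [g] in the image of [G_y] ([pi1_path]).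

    Two constructions enlarge the target. Write [wreath p Q] for the wreath
    product of F_p and [Q], i.e. the permutations
    [(x, h) |-> (q x, h + a x)] of [Q * F_p].

    First, let [r] be a representation in [Q] in which the kernel on every
    [G_v] is the [k]-th term of the chief series. The characters of condition
    (II) extend from these kernels to cocycles of [G_v] acting on [Q]
    ([extend_to_cocycle]). The two cocycles which an edge group inherits from
    its ends agree on the kernel, so their difference is a coboundary
    ([free_cocycle_coboundary]), which provides the elements of the edges. The
    result is a representation in [wreath p Q] with kernels the [k+1]-st terms
    ([lift_rep]). Starting from the trivial representation one reaches a [k]
    for which the finitely many vertex groups on the given path embed
    ([rep_of_chief]).

    Secondly, edge elements may be modified by functions on [Q] that are
    invariant under the edge groups, leaving the vertex groups alone
    ([twisted_rep]). For a reduced path starting with the edge [y1], the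
    indicator function of the image of [G_y1] changes the value of the path,
    provided that the values of all shorter paths beginning at the second edge
    lie outside the vertex groups ([path_val_bumped]): the path can traverse
    the same coset of [G_y1] a second time only if one of these values lies in
    a vertex group. One step for every edge of
    the path yields a representation in which the value of the path is not in
    the image of any vertex group ([reduced_escapes]), so that
    [g0 y1 g1 ... ym gm] survives. *)

Lemma morph_fun1 (H Q : groupType) (a : H -> Q) :
  {morph a : g h / g * h} -> a 1 = 1.
Proof. by move=> aM; apply: (mulgI (a 1)); rewrite -aM !mulg1. Qed.

Lemma morph_funV (H Q : groupType) (a : H -> Q) :
  {morph a : g h / g * h} -> forall g, a g^-1 = (a g)^-1.
Proof.
by move=> aM g; apply: (mulgI (a g)); rewrite -aM !mulgV morph_fun1.
Qed.

(** * Wreath products with F_p *)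

Section Wreath.
Variables (p : nat) (Q : finGroupType).

(** The pair [(a, q)] stands for the permutation
    [(x, h) |-> (q x, h + a x)] of [Q * F_p]; the base group consists of all
    functions on [Q], on which [Q] acts by left translation. *)
Definition wreath := ({ffun Q -> 'F_p} * Q)%type.
HB.instance Definition _ := Finite.on wreath.
Implicit Types a b c : wreath.

Definition wreath_one : wreath := ([ffun=> 0%R], 1).
Definition wreath_mul a b : wreath :=
  ([ffun x => (a.1 (b.2 * x)%g + b.1 x)%R], a.2 * b.2).
Definition wreath_inv a : wreath :=
  ([ffun x => (- a.1 (a.2^-1 * x)%g)%R], a.2^-1).

Fact wreath_mulA : associative wreath_mul.
Proof.
move=> a b c; congr pair; last exact: mulgA.
by apply/ffunP=> x; rewrite !ffunE GRing.addrA mulgA.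
Qed.

Fact wreath_mul1 : left_id wreath_one wreath_mul.
Proof.
case=> f q; congr pair; last exact: mul1g.
by apply/ffunP=> x; rewrite !ffunE GRing.add0r.
Qed.

Fact wreath_mulV : left_inverse wreath_one wreath_inv wreath_mul.
Proof.
case=> f q; congr pair; last exact: mulVg.
by apply/ffunP=> x; rewrite !ffunE /= mulKg GRing.addNr.
Qed.

HB.instance Definition _ :=
  Finite_isGroup.Build wreath wreath_mulA wreath_mul1 wreath_mulV.

Lemma wreath_mulE a b :
  a * b = ([ffun x => (a.1 (b.2 * x)%g + b.1 x)%R], a.2 * b.2).
Proof. by []. Qed.

Lemma wreath_oneE : 1 = ([ffun=> 0%R], 1) :> wreath.
Proof. by []. Qed.

Lemma wreath_pgroup : prime p -> p.-group [set: Q] -> p.-group [set: wreath].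
Proof.
move=> p_pr pQ; rewrite /pgroup cardsT card_prod card_ffun card_Fp //.
by rewrite pnatM pnatX pnat_id // -cardsT.
Qed.

End Wreath.

(** * Representations of a graph of groups *)

Section Representations.
Variables (X : graph) (G : graph_of_fingroups X).
Implicit Types (y z : edge X) (v : vert X).

(** The edge group is indexed by a geometric edge [e] of which [y] is one of the
    two orientations. With the equation as an argument, the embeddings along
    [y] and along [opp y] have the same source, so that the groups of
    [to_uedge y] and [to_uedge (opp y)] need no transport. *)
Definition incl y e (ye : to_uedge y = e) : egrp G e -> vgrp G (tgt y) :=
  let: erefl := ye in fun g => emor G y g.

Lemma inclM y e (ye : to_uedge y = e) : {morph incl ye : g h / g * h}.
Proof. by case: e / ye => g h; rewrite /= morphM ?inE. Qed.

(** No maximal subtree enters: these are the homomorphisms to [Q] from the group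
    in which all edges have a free letter, of which [pi1] is a quotient and a
    retract. *)
Record rep (Q : groupType) := Rep {
  rvert : forall v, vgrp G v -> Q;
  redge : edge X -> Q;
  rvertM : forall v, {morph @rvert v : g h / g * h};
  redgeV : forall y, redge (opp y) = (redge y)^-1;
  redgeC : forall y e (ye : to_uedge y = e) (oye : to_uedge (opp y) = e) g,
    redge y * rvert (incl ye g) = rvert (incl oye g) * redge y
}.

Section RepTheory.
Variables (Q : groupType) (r : rep Q).

Lemma rvert1 v : rvert r (1 : vgrp G v) = 1.
Proof. exact/morph_fun1/rvertM. Qed.

Lemma rvertV v (g : vgrp G v) : rvert r g^-1 = (rvert r g)^-1.
Proof. exact/morph_funV/rvertM. Qed.

End RepTheory.

Lemma rvert_inclE (Q : groupType) (a : forall v, vgrp G v -> Q) y y' e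
    (ye : to_uedge y = e) (ye' : to_uedge y' = e) g :
  y = y' -> a _ (incl ye g) = a _ (incl ye' g).
Proof.
by move=> yy'; case: y' / yy' ye' => ye'; rewrite (eq_irrelevance ye ye').
Qed.

(** The relation for [opp y] is the relation for [y] read backwards, hence only
    positively oriented edges have to be considered. *)
Lemma rep_of_oriented (Q : groupType) (Eplus : set (edge X))
    (a : forall v, vgrp G v -> Q) (s : edge X -> Q) :
    is_orientation Eplus ->
    (forall v, {morph a v : g h / g * h}) ->
    (forall y, Eplus y -> forall e (ye : to_uedge y = e)
       (oye : to_uedge (opp y) = e) g,
       s y * a _ (incl ye g) = a _ (incl oye g) * s y) ->
  exists2 r : rep Q, rvert r = a & forall y, Eplus y -> redge r y = s y.
Proof.
move=> Eplus_or aM sC.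
pose s' y := if `[< Eplus y >] then s y else (s (opp y))^-1.
have s'V y : s' (opp y) = (s' y)^-1.
  rewrite /s'; case: (Eplus_or y) => -[/asboolP + /asboolP].
    by rewrite asbool_neg oppK => -> /negbTE->.
  by rewrite asbool_neg => /negbTE-> ->; rewrite invgK.
have s'C y e (ye : to_uedge y = e) (oye : to_uedge (opp y) = e) g :
    s' y * a _ (incl ye g) = a _ (incl oye g) * s' y.
  rewrite /s'; case: asboolP => [/sC// | nEy].
  have Eoy : Eplus (opp y) by case: (Eplus_or y) => -[].
  have ooye : to_uedge (opp (opp y)) = e by rewrite to_uedge_opp.
  have := sC _ Eoy e oye ooye g.
  rewrite (rvert_inclE a ooye ye g (oppK y)) => E.
  by apply: (mulgI (s (opp y))); rewrite mulKVg mulgA E mulgK.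
by exists (Rep aM s'V s'C) => //= y /asboolP Ey; rewrite /s' Ey.
Qed.

(** A path [g0 y1 g1 ... ym gm] is stored as [g0] and the list of the pairs
    [(yi, gi)], since [gi] belongs to the vertex group at the end of [yi]. *)
Definition pstep := {y : edge X & vgrp G (tgt y)}.
Local Notation step := (Tagged (fun y => vgrp G (tgt y))).
Implicit Types (s : seq pstep) (l : pstep).

Fixpoint path_val (Q : groupType) (r : rep Q) s : Q :=
  if s is l :: s' then redge r (tag l) * rvert r (tagged l) * path_val r s'
  else 1.

Lemma path_val_cat (Q : groupType) (r : rep Q) s1 s2 :
  path_val r (s1 ++ s2) = path_val r s1 * path_val r s2.
Proof. by elim: s1 => [|l s1 IH] /=; rewrite ?mul1g // IH !mulgA. Qed.

(** Consecutive edges are not required to match: only backtracking matters for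
    the survival of a path in finite quotients. *)
Fixpoint reduced s : Prop :=
  if s is l :: s' then
    (if s' is l' :: _ then
       tag l' = opp (tag l) -> forall a, tagged l <> emor G (tag l) a
     else True) /\ reduced s'
  else True.

Lemma reduced_prefix s1 s2 : reduced (s1 ++ s2) -> reduced s1.
Proof.
elim: s1 => [//|l s1 IH] /= [red /IH red1]; split=> //.
by case: s1 red {IH red1}.
Qed.

(** Quantifying over prefixes is what makes the induction on the path work; see
    [path_val_bumped]. *)
Definition escapes (Q : groupType) (r : rep Q) s : Prop :=
  forall s1 l s2, s = s1 ++ l :: s2 ->
    forall v (g : vgrp G v), path_val r (rcons s1 l) <> rvert r g.

(** * Survival of reduced paths *)

Section Twist.
Variables (p : nat) (Q : finGroupType) (r : rep Q).
Variable d : edge X -> Q -> 'F_p.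
Hypothesis dV : forall y x, d (opp y) (redge r y * x) = (- d y x)%R.
Hypothesis dC : forall y (g : egrp G (to_uedge y)) x,
  d y (rvert r (emor G y g) * x) = d y x.

Definition twist_vert v (g : vgrp G v) : wreath p Q := ([ffun=> 0%R], rvert r g).
Definition twist_edge y : wreath p Q := ([ffun x => d y x], redge r y).

Fact twist_vertM v : {morph @twist_vert v : g h / g * h}.
Proof.
move=> g h; rewrite wreath_mulE /twist_vert /= rvertM; congr pair.
by apply/ffunP=> x; rewrite !ffunE GRing.addr0.
Qed.

Fact twist_edgeV y : twist_edge (opp y) = (twist_edge y)^-1.
Proof.
apply: (mulIg (twist_edge y)); rewrite mulVg wreath_mulE wreath_oneE /=.
rewrite redgeV mulVg; congr pair.
by apply/ffunP=> x; rewrite !ffunE dV GRing.addNr.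
Qed.

Fact twist_edgeC y e (ye : to_uedge y = e) (oye : to_uedge (opp y) = e) g :
  twist_edge y * twist_vert (incl ye g) = twist_vert (incl oye g) * twist_edge y.
Proof.
rewrite !wreath_mulE /= redgeC; congr pair.
apply/ffunP=> x; rewrite !ffunE GRing.addr0 GRing.add0r.
by case: e / ye oye g => oye g; rewrite dC.
Qed.

(** The values at the vertices are not touched: if [r] is injective on a vertex
    group, so is the twist. Moreover an element of [wreath p Q] with nonzero
    function part is outside of all vertex groups. *)
Definition twisted_rep : rep (wreath p Q) := Rep twist_vertM twist_edgeV twist_edgeC.

Lemma path_val_twist2 s : (path_val twisted_rep s).2 = path_val r s.
Proof. by elim: s => //= l s <-. Qed.

Lemma path_val_twist1 l s x :
  (path_val twisted_rep (l :: s)).1 x =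
  (d (tag l) (rvert r (tagged l) * path_val r s * x)%g + (path_val twisted_rep s).1 x)%R.
Proof.
by rewrite /= !ffunE path_val_twist2 GRing.addr0 mulgA.
Qed.

End Twist.

Section Bump.
Variables (p : nat) (Q : finGroupType) (r : rep Q).
Variable y1 : edge X.

Let E x : bool := [exists a, x == rvert r (emor G y1 a)].

Lemma bumpE_mul a x : E (rvert r (emor G y1 a) * x) = E x.
Proof.
apply/existsP/existsP=> -[b /eqP xb].
  exists (a^-1 * b); apply/eqP; rewrite morphM ?inE // morphV ?inE // rvertM rvertV.
  by rewrite -xb mulKg.
by exists (a * b); rewrite morphM ?inE // rvertM -xb.
Qed.

Lemma bumpE_inv x : E x^-1 = E x.
Proof.
have imp w : E w -> E w^-1.
  case/existsP=> b /eqP->; apply/existsP; exists b^-1.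
  by rewrite morphV ?inE // rvertV.
by apply/idP/idP=> /imp; rewrite ?invgK.
Qed.

(** The indicator function of the edge [(y1, E)] in the graph with edges the
    pairs of an edge [y] and a coset of the image of [G_y]; the sign accounts
    for traversals of [y1] in the opposite direction. *)
Definition edge_bump y x : 'F_p :=
  (((y == y1) && E x)%:R - ((y == opp y1) && E ((redge r y1)^-1 * x)%g)%:R)%R.

Fact edge_bumpV y x : edge_bump (opp y) (redge r y * x) = (- edge_bump y x)%R.
Proof.
rewrite /edge_bump GRing.opprB; congr (_%:R - _%:R)%R.
  have -> : (opp y == y1) = (y == opp y1).
    by apply/eqP/eqP => [<-|->]; rewrite oppK.
  by case: eqP => // ->; rewrite redgeV.
have -> : (opp y == opp y1) = (y == y1).
  by apply/eqP/eqP => [/(congr1 (@opp X))|->//]; rewrite !oppK.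
by case: eqP => // ->; rewrite mulKg.
Qed.

Fact edge_bumpC y (g : egrp G (to_uedge y)) x :
  edge_bump y (rvert r (emor G y g) * x) = edge_bump y x.
Proof.
rewrite /edge_bump; congr ((nat_of_bool _)%:R - (nat_of_bool _)%:R)%R.
  by case: eqP => //= yy1; move: g; rewrite yy1 => g; rewrite bumpE_mul.
case: eqP => //= yy1; move: g; rewrite yy1 => g.
have [b C] : exists b,
    redge r y1 * rvert r (emor G y1 b) = rvert r (emor G (opp y1) g) * redge r y1.
  have ye := to_uedge_opp y1.
  exists (ecast e (egrp G e) ye g).
  have /= -> := redgeC r (erefl (to_uedge y1)) ye (ecast e (egrp G e) ye g).
  by congr (_ * _); case: _ / ye.
have -> : (redge r y1)^-1 * (rvert r (emor G (opp y1) g) * x)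
     = rvert r (emor G y1 b) * ((redge r y1)^-1 * x).
  apply: (mulgI (redge r y1)).
  by rewrite mulKVg !mulgA C mulgK.
by rewrite bumpE_mul.
Qed.

Definition bumped_rep := twisted_rep edge_bumpV edge_bumpC.

Lemma edge_bump1 : edge_bump y1 1 = 1%R.
Proof.
have E1 : E 1 by apply/existsP; exists 1; rewrite morph1 rvert1.
rewrite /edge_bump eqxx E1; case: eqP => [y1y1|_]; last by rewrite GRing.subr0.
by case: (opp_neq (esym y1y1)).
Qed.

(** Read from right to left, the path [y1 g1 s1 s2] moves the point
    [(g1 s1 s2)^-1] through [Q] and arrives at [1] just before [y1]. A step
    [(y, g)] of the remaining path contributes to the function part exactly if
    it traverses the edge [(y1, E)]. In the direction of [y1], the part of the
    path up to this step would have a value in a vertex group. In the opposite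
    direction, so would the part before this step, or, when that is empty,
    [g1] would belong to [G_y1] and the path would not be reduced. *)
Lemma path_val_bumped (g1 : vgrp G (tgt y1)) s1 s2 :
    injective (@rvert _ r (tgt y1)) ->
    reduced (step g1 :: s1 ++ s2) ->
    escapes r (s1 ++ s2) ->
  (path_val bumped_rep s2).1
     (rvert r g1 * path_val r s1 * path_val r s2)^-1 = 0%R.
Proof.
move=> inj1; elim: s2 s1 => [|[y g] s2 IH] s1 red esc.
  by rewrite /= ffunE.
rewrite path_val_twist1 [tag _]/= [tagged _]/=.
have -> : rvert r g1 * path_val r s1 * path_val r (step g :: s2)
       = rvert r g1 * path_val r (rcons s1 (step g)) * path_val r s2.
  by rewrite -cats1 path_val_cat /= !mulgA mulg1.
rewrite IH ?cat_rcons // GRing.addr0 -cats1 path_val_cat /= mulg1 /edge_bump.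
set u := rvert r g1 * path_val r s1.
have -> : rvert r g * path_val r s2 *
    (rvert r g1 * (path_val r s1 * (redge r y * rvert r g)) * path_val r s2)^-1
    = (u * redge r y)^-1.
  by rewrite /u !invgM !mulgA mulgK mulgV mul1g.
have nE1 : (y == y1) && E (u * redge r y)^-1 = false.
  apply/negP=> /andP[/eqP yy1]; rewrite bumpE_inv => /existsP[a /eqP ua].
  subst y.
  apply: (esc s1 _ s2 erefl _ (g1^-1 * emor G y1 a * g)).
  rewrite -cats1 path_val_cat /= mulg1 !rvertM rvertV -ua /u.
  by rewrite !mulgA mulVg mul1g.
have nE2 : (y == opp y1) && E ((redge r y1)^-1 * (u * redge r y)^-1)%g = false.
  apply/negP=> /andP[/eqP yy1]; rewrite -invgM -mulgA bumpE_inv => /existsP[a /eqP].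
  rewrite yy1 redgeV mulVg mulg1 => ua.
  case/lastP: s1 @u red esc ua {IH nE1} =>
    [|s1 [y' g']] u red esc ua.
    case: red => /= /(_ yy1 a) red _; apply: red.
    by apply: inj1; rewrite -ua /u /= mulg1.
  apply: (esc s1 (step g') _ _ _ (g1^-1 * emor G y1 a)).
    by rewrite cat_rcons.
  by rewrite rvertM rvertV -ua /u mulKg.
by rewrite nE1 nE2 GRing.subr0.
Qed.

End Bump.

(** Each edge of the path, from the last to the first, costs one wreath product.
    After the step for [y1] all nonempty prefixes have function part [1] at a
    suitable point, as only the first edge contributes. *)
Lemma reduced_escapes (p : nat) (Q : finGroupType) (r : rep Q) s :
    prime p -> p.-group [set: Q] -> reduced s ->
    {in s, forall l, injective (@rvert _ r (tgt (tag l)))} ->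
  exists (Q' : finGroupType) (r' : rep Q'),
    [/\ p.-group [set: Q'],
        forall v, injective (@rvert _ r v) -> injective (@rvert _ r' v)
      & escapes r' s].
Proof.
move=> p_pr pQ; elim: s => [|[y1 g1] s IH] red inj.
  by exists Q, r; split=> // -[|? ?] ? ?.
have [|l ls|Q' [r' [pQ' inj' esc]]] := IH; first by case: red.
  by apply: inj; rewrite inE ls orbT.
exists (wreath p Q'), (bumped_rep p r' y1); split; first exact: wreath_pgroup.
  by move=> v iv g h [] /(inj' v iv).
have inj1 : injective (@rvert _ r' (tgt y1)).
  by apply/inj'/(inj (step g1))/mem_head.
have prefix_escapes s3 s2 v (g : vgrp G v) : s = s3 ++ s2 ->
    path_val (bumped_rep p r' y1) (step g1 :: s3) <> rvert (bumped_rep p r' y1) g.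
  move=> Es; pose x := (rvert r' g1 * path_val r' s3)^-1.
  move=> /(congr1 (fun a : wreath p Q' => a.1 x)).
  rewrite path_val_twist1 [in RHS]/= ffunE /x /= mulgV edge_bump1.
  have := @path_val_bumped p _ r' y1 g1 [::] s3; rewrite /= mulg1 => ->.
  - by rewrite GRing.addr0 => /eqP; rewrite GRing.oner_eq0.
  - by [].
  - by move: red; rewrite Es -cat_cons => /reduced_prefix.
  - move=> s1 l s4 Es3; apply: (esc s1 l (s4 ++ s2)).
    by rewrite Es Es3 -catA.
move=> [|l1 s1] l s2 /= [<- Es] v g; first exact: (prefix_escapes [::] s).
by apply: (prefix_escapes (rcons s1 l) s2); rewrite cat_rcons.
Qed.
End Representations.

(** * Cocycles of semiregular actions *)

(** Choose a base point in each orbit of [H] acting on [Q] by left translation;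
    [a (sec x)] carries the base point to [x]. *)
Lemma equivariant_section (H Q : finGroupType) (a : H -> Q) :
    {morph a : g h / g * h} ->
  exists sec : Q -> H, forall h x, a (sec (a h * x)) = a h * a (sec x).
Proof.
move=> aM.
have a1 := morph_fun1 aM; pose r x := odflt x [pick y | [exists h, y == a h * x]].
pose sec x := odflt 1 [pick h | x == a h * r x].
have rE h x : r (a h * x) = r x.
  pose P z y := [exists k, y == a k * z].
  have PE : P (a h * x) =1 P x.
    move=> y; apply/idP/idP=> /existsP[k /eqP->]; apply/existsP.
      by exists (k * h); rewrite aM mulgA.
    by exists (k * h^-1); rewrite mulgA -aM mulgVK.
  rewrite /r (eq_pick PE); case: pickP => //= nP; suff: P x x by rewrite nP.
  by apply/existsP; exists 1; rewrite a1 mul1g.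
have rP x : exists h, x = a h * r x.
  rewrite /r; case: pickP => [y /existsP[h /eqP->]|_] /=.
    by exists h^-1; rewrite mulgA -aM mulVg a1 mul1g.
  by exists 1; rewrite a1 mul1g.
have secP x : a (sec x) * r x = x.
  rewrite /sec; case: pickP => [h /eqP//|nP] /=.
  by have [h xh] := rP x; have := nP h; rewrite -xh eqxx.
exists sec => h x; apply: (mulIg (r x)).
by rewrite -{1}(rE h) secP -mulgA secP.
Qed.

Section Cocycles.
Variables (p : nat) (H Q : finGroupType) (a : H -> Q).
Hypothesis aM : {morph a : g h / g * h}.

Definition cocycle (c : H -> Q -> 'F_p) :=
  forall g h x, c (g * h) x = (c g (a h * x)%g + c h x)%R.

(** The primitive [f] is zero at the base points of the orbits. It is
    well defined as [c] vanishes on the stabilisers, which are all equal to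
    the kernel of [a]. *)
Lemma free_cocycle_coboundary c : cocycle c ->
    (forall g x, a g = 1 -> c g x = 0%R) ->
  exists f : Q -> 'F_p, forall g x, c g x = (f (a g * x)%g - f x)%R.
Proof.
move=> cM c0; have [sec secE] := equivariant_section aM.
have aV := morph_funV aM; pose r x := (a (sec x))^-1 * x.
exists (fun x => c (sec x) (r x)) => g x.
have -> : r (a g * x) = r x by rewrite /r secE invgM -mulgA mulKg.
have : c (g * sec x) (r x) = c (sec (a g * x)) (r x).
  pose n := (sec (a g * x))^-1 * (g * sec x).
  have an : a n = 1 by rewrite !aM aV secE mulVg.
  have -> : g * sec x = sec (a g * x) * n by rewrite mulKVg.
  by rewrite cM an mul1g (c0 n) // GRing.addr0.
by rewrite cM mulKVg => <-; rewrite GRing.addrK.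
Qed.

(** This is the cocycle of the representation of [H] induced from the kernel of
    [a]: [g] moves [x] to [a g * x], and the comparison with the chosen elements
    leading to these two points is in the kernel. Invariance under conjugation
    makes the value independent of [x] when [g] is in the kernel. *)
Lemma extend_to_cocycle (psi : H -> 'F_p) :
    (forall g h, a g = 1 -> a h = 1 -> psi (g * h) = (psi g + psi h)%R) ->
    (forall g h, a g = 1 -> psi (g ^ h) = psi g) ->
  exists2 c, cocycle c & forall g x, a g = 1 -> c g x = psi g.
Proof.
move=> psiM psiJ; have [sec secE] := equivariant_section aM.
have aV := morph_funV aM.
pose k g x := (sec (a g * x))^-1 * (g * sec x).
have ak g x : a (k g x) = 1 by rewrite /k !aM aV secE mulVg.
exists (fun g x => psi (k g x)) => [g h x|g x ag].
  by rewrite -psiM // /k aM !mulgA mulgK.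
by rewrite /k ag mul1g -[RHS](psiJ g (sec x)).
Qed.

End Cocycles.

(** * Lifting along the chief series *)

Section Lift.
Variables (X : graph) (G : graph_of_fingroups X) (p : nat).
Variables (Q : finGroupType) (r : rep G Q).
Variable Eplus : set (edge X).
Hypothesis Eplus_or : is_orientation Eplus.
Variable psi : forall v, vgrp G v -> 'F_p.
Hypothesis psiM : forall v (g h : vgrp G v),
  rvert r g = 1 -> rvert r h = 1 -> psi (g * h) = (psi g + psi h)%R.
Hypothesis psiJ : forall v (g h : vgrp G v),
  rvert r g = 1 -> psi (g ^ h) = psi g.
Hypothesis psiE : forall y e (ye : to_uedge y = e) (oye : to_uedge (opp y) = e) g,
  rvert r (incl ye g) = 1 -> psi (incl ye g) = psi (incl oye g).

(** The functions attached to the edges solve the equation that the conjugation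
    relation imposes on the function parts; it is solvable because the two
    cocycles of an edge group have the same restriction [psi] to the kernel. *)
Lemma lift_rep : exists r' : rep G (wreath p Q),
  forall v (g : vgrp G v), rvert r' g = 1 <-> rvert r g = 1 /\ psi g = 0%R.
Proof.
have exc v : exists c : vgrp G v -> Q -> 'F_p,
    cocycle (@rvert _ _ _ r v) c /\ forall g x, rvert r g = 1 -> c g x = psi g.
  have [c ? ?] := extend_to_cocycle (@rvertM _ _ _ r v) (@psiM v) (@psiJ v).
  by exists c.
pose c v := projT1 (cid (exc v)).
have cP v : cocycle (@rvert _ _ _ r v) (c v) /\
    forall g x, rvert r g = 1 -> c v g x = psi g.
  exact: (projT2 (cid (exc v))).
have cM v := (cP v).1; have cK v := (cP v).2; clearbody c.
pose a v (g : vgrp G v) : wreath p Q := ([ffun x => c v g x], rvert r g).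
have aM v : {morph a v : g h / g * h}.
  move=> g h; rewrite wreath_mulE /a /= rvertM; congr pair.
  by apply/ffunP=> x; rewrite !ffunE cM.
have /choice[f fP] : forall y, exists f : Q -> 'F_p,
    forall e (ye : to_uedge y = e) (oye : to_uedge (opp y) = e) g x,
    (c _ (incl oye g) (redge r y * x)%g + f x
      = f (rvert r (incl ye g) * x)%g + c _ (incl ye g) x)%R.
  move=> y; pose oye := to_uedge_opp y; pose ye := erefl (to_uedge y).
  pose d g x := (c _ (incl oye g) (redge r y * x)%g - c _ (incl ye g) x)%R.
  have [|||f fP] := @free_cocycle_coboundary p _ Q
    (fun g => rvert r (incl ye g)) _ d.
  - by move=> g h; rewrite inclM rvertM.
  - move=> g h x; rewrite /d !inclM !cM /= mulgA -(redgeC r ye oye) -mulgA.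
    by rewrite GRing.opprD GRing.addrACA.
  - move=> g x yg1; have zg1 : rvert r (incl oye g) = 1.
      apply: (mulIg (redge r y)).
      by rewrite -(redgeC r ye oye) yg1 mulg1 mul1g.
    by rewrite /d !cK // (psiE oye) // GRing.subrr.
  exists f => e ye'; case: e / ye' => oye' g x.
  have := fP g x; rewrite /d (eq_irrelevance oye' oye) => /eqP.
  by rewrite GRing.subr_eq GRing.addrAC -GRing.subr_eq GRing.opprK => /eqP.
pose s y : wreath p Q := ([ffun x => f y x], redge r y).
have [y _ e ye oye g|r' r'a _] := @rep_of_oriented _ _ _ _ a s Eplus_or aM.
  rewrite !wreath_mulE /= (redgeC r ye oye); congr pair.
  by apply/ffunP=> x; rewrite !ffunE fP.
exists r' => v g; rewrite r'a /a wreath_oneE; split.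
  by case=> /ffunP/(_ 1) + rg1; rewrite !ffunE cK.
by case=> rg1 psi0; rewrite rg1; congr pair; apply/ffunP=> x; rewrite !ffunE cK.
Qed.

End Lift.

Section ChiefSeries.
Variables (p : nat) (gT : finGroupType) (C : nat -> {group gT}).
Hypotheses (p_pr : prime p) (pG : p.-group [set: gT]) (C_chief : chief_series p C).

Lemma chief_norm k g : g \in 'N(C k).
Proof.
case: C_chief => _ _ nC _ _; have /andP[_ /fintype.subsetP] := nC k.
by apply; rewrite inE.
Qed.

Lemma chief_vanish : exists n, forall k, n <= k -> C k :=: 1.
Proof.
case: C_chief => _ dC _ _ [n Cn1]; exists n => k /subnKC <-.
elim: (k - n) => [|j IH]; first by rewrite addn0.
apply/trivgP; rewrite addnS -IH; exact: dC.
Qed.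

(** A normal subgroup of order [p] of a finite [p]-group is central. *)
Lemma chief_factor_central k g h : g \in C k -> coset (C k.+1) (g ^ h) = coset (C k.+1) g.
Proof.
case: C_chief => _ dC nC cC _ gC.
set N := C k.+1; have nN x : x \in 'N(N) by apply: chief_norm.
have gq : coset N g \in C k / N by apply: mem_quotient.
have hq : coset N h \in [set: gT] / N by apply: mem_quotient; rewrite inE.
suff cen : C k / N \subset 'Z([set: gT] / N).
  have /centerP[_ /(_ _ hq) com] := fintype.subsetP cen _ gq.
  by rewrite morphJ //; apply/conjg_fixP/commgP.
case: (cC k) => [/eqP|cp]; first by rewrite -trivg_card1 => /eqP->; apply: sub1G.
have pr : prime #|C k / N| by rewrite cp.
have nCq : C k / N <| [set: gT] / N by apply: quotient_normal.
have nil : nilpotent ([set: gT] / N) by apply/pgroup_nil/quotient_pgroup/pG.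
have nt : C k / N != 1 by rewrite trivg_card1 cp; case: p p_pr => [|[]].
have := meet_center_nil nil nCq nt; apply: contraNT => nsub.
by rewrite prime_TIg.
Qed.

End ChiefSeries.

Section Filtration.
Variables (p : nat) (X : graph) (G : graph_of_fingroups X).
Variables (CV : forall v : vert X, nat -> {group vgrp G v})
          (CE : forall e : uedge X, nat -> {group egrp G e}).
Hypotheses (p_pr : prime p) (G_p : graph_of_pgroups G p).
Hypotheses (CV_chief : forall v, chief_series p (CV v))
           (CE_chief : forall e, chief_series p (CE e)).
Hypothesis hI : forall (k : nat) (y : edge X),
  emor G y @* CE (to_uedge y) k
    = (emor G y @* [set: egrp G (to_uedge y)]) :&: CV (tgt y) k.
Hypothesis hII : forall k : nat,
  exists (phiV : forall v, {morphism (CV v k / CV v k.+1) >-> 'F_p})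
         (phiE : forall e, {morphism (CE e k / CE e k.+1) >-> 'F_p}),
    [/\ forall v, 'injm (phiV v),
        forall e, 'injm (phiE e)
      & forall y : edge X,
          {in CE (to_uedge y) k / CE (to_uedge y) k.+1,
             phiV (tgt y) \o induced (emor G y) (CV (tgt y) k.+1)
               =1 phiE (to_uedge y)}].
Variable Eplus : set (edge X).
Hypothesis Eplus_or : is_orientation Eplus.

(** This is condition (I) in the form in which it is used: the chief series of
    an edge group is induced from either end. *)
Lemma mem_incl_chief k y e (ye : to_uedge y = e) g :
  (incl ye g \in CV (tgt y) k) = (g \in CE e k).
Proof.
case: e / ye g => g /=.
have := hI k y => /setP/(_ (emor G y g)).
have gi : emor G y g \in emor G y @* [set: egrp G (to_uedge y)].
  by rewrite mem_morphim ?finset.in_setT.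
rewrite finset.in_setI gi => /= <-.
apply/idP/idP=> [/morphimP[h _ hE gh]|gE]; last by rewrite mem_morphim ?finset.in_setT.
by rewrite (injmP (emor_inj G y) g h) ?finset.in_setT.
Qed.

(** The inductive step applies [lift_rep] to the characters of condition (II),
    whose kernel in the [k]-th term is the next term. *)
Lemma rep_of_chief k : exists (Q : finGroupType) (r : rep G Q),
  p.-group [set: Q] /\ forall v (g : vgrp G v), rvert r g = 1 <-> g \in CV v k.
Proof.
elim: k => [|k [Q [r [pQ rK]]]].
  pose r : rep G 'I_1 :=
    @Rep X G 'I_1 (fun _ _ => 1) (fun=> 1) (fun _ _ _ => esym (mulg1 1))
      (fun=> esym (invg1 _)) (fun _ _ _ _ _ => erefl).
  exists 'I_1, r; split; first by rewrite /pgroup cardsT card_ord.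
  by move=> v g; case: (CV_chief v) => -> _ _ _ _; rewrite inE.
have [phiV [phiE [injV injE phiVE]]] := hII k.
have nV v := chief_norm (CV_chief v) k.+1.
pose psi v (g : vgrp G v) : 'F_p := phiV v (coset (CV v k.+1) g).
have [v g h /rK gk /rK hk|v g h /rK gk|y e ye oye g /rK gk|r' r'K] :=
  @lift_rep X G p Q r Eplus Eplus_or psi.
- by rewrite /psi morphM // morphM ?mem_quotient.
- by rewrite /psi (chief_factor_central p_pr (G_p.1 v) (CV_chief v)).
- have psiE y' (ye' : to_uedge y' = e) :
      psi _ (incl ye' g) = phiE e (coset (CE e k.+1) g).
    rewrite mem_incl_chief in gk.
    case: e / ye' g ye oye gk => g _ _ gk /=.
    rewrite -phiVE ?mem_quotient // /psi /=; congr (phiV _ _).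
    rewrite inducedE //.
    - by case: (CE_chief (to_uedge y')).
    - by case: (CV_chief (tgt y')).
    - by rewrite hI subsetIr.
  by rewrite !psiE.
exists (wreath p Q), r'; split; first exact: wreath_pgroup.
move=> v g; rewrite r'K rK; split=> [[gk psi0]|gk1].
  apply: coset_idr => //.
  by apply: (injmP (injV v)); rewrite ?mem_quotient ?group1 // morph1.
have gk : g \in CV v k.
  by case: (CV_chief v) => _ dC _ _ _; apply: (fintype.subsetP (dC k)).
by split=> //; rewrite /psi coset_id // morph1.
Qed.

End Filtration.

(** * Homomorphisms out of a presented group *)

Section Presented.
Variables (S : choiceType) (R : word S -> word S -> Prop).
Variables (Q : groupType) (f : S -> Q).

Fixpoint word_val (u : word S) : Q :=
  if u is (s, b) :: u' then (if b then (f s)^-1 else f s) * word_val u' else 1.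

Lemma word_val_cat u v : word_val (u ++ v) = word_val u * word_val v.
Proof. by elim: u => [|[s b] u IH] /=; rewrite ?mul1g // IH mulgA. Qed.

Lemma presented_lift : (forall u v, R u v -> word_val u = word_val v) ->
  exists h : {multiplicative presented R -> Q},
    forall u, h (pres_class R u) = word_val u.
Proof.
move=> fR.
have congE u v : word_cong R u v -> word_val u = word_val v.
  elim=> {u v} [//|u v _ ->|u v w _ -> _ ->|u u' v v' _ E _ E'|s b|u v /fR] //.
    by rewrite !word_val_cat E E'.
  by case: b => /=; rewrite mulg1 (mulVg, mulgV).
pose h (x : presented R) := word_val (generic_quotient.repr x).
have hE u : h (pres_class R u) = word_val u by apply/congE/repr_class.
have hM : {morph h : x y / x * y}.
  by move=> x y; rewrite -(pres_classK x) -(pres_classK y) [_ * _]pres_mulE !hE word_val_cat.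
by exists (HB.pack_for (Multiplicative.type (presented R) Q) h
  (isMultiplicative.Build _ _ h hM)).
Qed.

End Presented.

(** * Walks and maximal subtrees *)

Section GraphWalks.
Variable X : graph.
Implicit Types (u v w : vert X) (y z : edge X) (s : seq (edge X)).

Lemma tgt_opp y : tgt (opp y) = org y.
Proof. by rewrite -org_opp oppK. Qed.

Lemma walk_cat u s1 s2 w :
  walk u (s1 ++ s2) w <-> exists2 v, walk u s1 v & walk v s2 w.
Proof.
elim: s1 u => [|y s1 IH] u /=; first by split=> [?|[v ->//]]; exists u.
split=> [[yu /IH[v ? ?]]|[v [yu ?] ?]]; first by exists v.
by split=> //; apply/IH; exists v.
Qed.

Lemma walk_rev u s v : walk u s v -> walk v (rev (map (@opp X) s)) u.
Proof.
elim: s u => [|y s IH] u /=; first by move->.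
case=> yu /IH sv; rewrite rev_cons -cats1; apply/walk_cat.
by exists (tgt y) => //=; rewrite org_opp tgt_opp.
Qed.

Lemma not_sorted_backtrack s : ~~ sorted (fun y z => z != opp y) s ->
  exists s1 y s2, s = s1 ++ y :: opp y :: s2.
Proof.
elim: s => [//|y [//|z s] IH] /=; rewrite negb_and negbK.
case/orP=> [/eqP->|/IH[s1 [x [s2 ->]]]]; first by exists [::], y, s.
by exists (y :: s1), x, s2.
Qed.

Lemma not_uniq_split s : ~~ uniq (map (@tgt X) s) ->
  exists s1 y s2 z s3, s = s1 ++ y :: s2 ++ z :: s3 /\ tgt y = tgt z.
Proof.
elim: s => [//|y s IH] /=; rewrite negb_and negbK => /orP[/mapP[z zs E]|/IH].
  by case/splitPr: zs => s2 s3; exists [::], y, s2, z, s3.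
by case=> s1 [x [s2 [z [s3 [-> E]]]]]; exists (y :: s1), x, s2, z, s3.
Qed.

Section WalkValue.
Variables (Q : groupType) (c : edge X -> Q).
Hypothesis cV : forall y, c (opp y) = (c y)^-1.

Fixpoint walk_val s : Q := if s is y :: s' then c y * walk_val s' else 1.

Lemma walk_val_cat s1 s2 : walk_val (s1 ++ s2) = walk_val s1 * walk_val s2.
Proof. by elim: s1 => [|y s1 IH] /=; rewrite ?mul1g // IH mulgA. Qed.

Lemma walk_val_rev s : walk_val (rev (map (@opp X) s)) = (walk_val s)^-1.
Proof.
elim: s => [|y s IH] /=; first by rewrite invg1.
by rewrite rev_cons -cats1 walk_val_cat IH /= mulg1 cV invgM.
Qed.

Variable T : subgraph X.
Hypothesis T_acyclic : forall s, {in s, forall y, sub_edge T y} -> ~ circuit s.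

(** By induction on the length: a walk that is not a circuit either backtracks,
    and the two edges cancel, or visits a vertex twice, and splits into two
    shorter closed walks. *)
Lemma closed_walk_val1 s v :
  {in s, forall y, sub_edge T y} -> walk v s v -> walk_val s = 1.
Proof.
have [n] := ubnP (size s); elim: n s v => // n IH s v; rewrite ltnS => sn sT sv.
have [-> //|s0] := eqVneq s [::].
have := T_acyclic sT => ncirc.
have [|/not_sorted_backtrack[s1 [y [s2 Es]]]] :=
  boolP (sorted (fun y z => z != opp y) s); last first.
  have sub : {in s1 ++ s2, forall y, sub_edge T y}.
    move=> x xs; apply: sT; move: xs.
    by rewrite Es !mem_cat !inE => /orP[]->; rewrite ?orbT.
  move: sv; rewrite Es => /walk_cat[w1 v1 /= [yw1 [_]]]; rewrite tgt_opp => v2.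
  rewrite walk_val_cat /= cV mulVKg -walk_val_cat.
  apply: (IH _ v) => //; last by apply/walk_cat; exists (org y); rewrite // yw1.
  by move: sn; rewrite Es !size_cat /= !addnS => /ltnW.
move=> srt; have /not_uniq_split[s1 [y [s2 [z [s3 [Es yz]]]]]] :
    ~~ uniq (map (@tgt X) s).
  apply/negP=> un; apply: ncirc; split=> //; first exact/eqP.
  by exists v.
have Es' : s = s1 ++ [:: y] ++ (s2 ++ [:: z]) ++ s3.
  by rewrite Es /= -catA.
move: sv; rewrite Es' => /walk_cat[w1 v1 /walk_cat[w2 /= [yw1 w2E]]].
move=> /walk_cat[w3 v3 v4].
have w32 : w3 = w2.
  by case/walk_cat: (v3) => w4 _ /= [_ <-]; rewrite -w2E.
rewrite walk_val_cat /= walk_val_cat [walk_val (s2 ++ _)](IH _ w2) //.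
- rewrite mul1g -[c y * _]/(walk_val (y :: s3)) -walk_val_cat; apply: (IH _ v).
  + move: sn; rewrite Es' !size_cat /=; apply: leq_trans.
    by rewrite ltn_add2l addn1 addSn !ltnS leq_addl.
  + move=> x xs; apply: sT; move: xs.
    by rewrite Es' !mem_cat !inE => /or3P[]->; rewrite ?orbT.
  + apply/walk_cat; by exists w1; rewrite //= w2E -w32; split.
- move: sn; rewrite Es' !size_cat /=; apply: leq_trans.
  by apply: leq_trans (leq_addl _ _); rewrite ltnS leq_addr.
- by move=> x xs; apply: sT; rewrite Es' 2!mem_cat [x \in _ ++ s3]mem_cat xs !orbT.
- by rewrite -{2}w32.
Qed.

End WalkValue.
End GraphWalks.

Section MaximalTree.
Variables (X : graph) (T : subgraph X).
Hypotheses (X_conn : graph_connected X) (T_max : is_maximal_subtree T).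

Lemma exit_edge (A : vert X -> Prop) u s w : walk u s w -> A u -> ~ A w ->
  exists y, A (org y) /\ ~ A (tgt y).
Proof.
elim: s u => [|y s IH] u /=; first by move-> => ? [].
case=> yu sw Au nAw; have [At|nAt] := pselect (A (tgt y)); first exact: IH At nAw.
by exists y; rewrite yu.
Qed.

(** If a subtree misses a vertex, some edge [y] leaves it; adding [y] with its
    endpoint gives a larger subtree. *)
Section AddEdge.
Variable y : edge X.
Hypotheses (Ty : sub_vert T (org y)) (nTy : ~ sub_vert T (tgt y)).

Let V' v := sub_vert T v \/ v = tgt y.
Let E' x := [\/ sub_edge T x, x = y | x = opp y].

Fact add_edge_opp x : E' x -> E' (opp x).
Proof.
case=> [/(@sub_opp _ T)|->|->]; rewrite ?oppK; first exact: Or31.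
  exact: Or33.
exact: Or32.
Qed.

Fact add_edge_tgt x : E' x -> V' (tgt x).
Proof.
by case=> [/(@sub_tgt _ T)|->|->]; rewrite ?tgt_opp; [left|right|left].
Qed.

Definition add_edge := Subgraph add_edge_opp add_edge_tgt.

Lemma add_edge_org x : E' x -> org x = tgt y -> x = opp y.
Proof.
case=> [Tx|->|//] xy; last by case: nTy; rewrite -xy.
by case: nTy; rewrite -xy -tgt_opp; apply/sub_tgt/sub_opp.
Qed.

Lemma add_edge_tgtE x : E' x -> tgt x = tgt y -> x = y.
Proof.
move=> /add_edge_opp Ex xy; rewrite -[x]oppK -[RHS]oppK.
by congr (opp _); apply: add_edge_org => //; rewrite org_opp.
Qed.

(** The new vertex is a leaf: a walk can only reach it by [y] and leave it by
    [opp y]. A circuit through [y] or [opp y] would therefore backtrack, unless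
    it is cut open at the new vertex, and then it visits [org y] twice. *)
Lemma add_edge_acyclic s : {in s, forall x, E' x} -> ~ circuit s.
Proof.
move=> sE circ; have [_ [v sv] srt un] := circ; have [_ _ acyc] := T_max.1.
have loopless : org y <> tgt y by move=> E; apply: nTy; rewrite -E.
have walk_rcons u s1 x w : walk u (rcons s1 x) w -> tgt x = w.
  by rewrite -cats1 => /walk_cat[? _ [_]].
have ys : y \notin s.
  apply/negP=> /splitPr ys; case: ys sE sv srt un {circ} => s1 [|z s2] sE sv srt un.
  - have vy : tgt y = v by case/walk_cat: sv => ? _ [_].
    case: s1 sE sv srt un => [|x s1] sE [xv sv] srt un.
      by apply: loopless; rewrite xv vy.
    have xE : x = opp y by apply: add_edge_org; rewrite ?xv //; apply/sE/mem_head.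
    case/lastP: s1 sE sv srt un => [|s1 z] sE sv srt un.
      by move: srt; rewrite /= xE oppK eqxx.
    case/walk_cat: sv => w /walk_rcons zw [yw _].
    move: un; rewrite /= => /andP[/negP + _]; apply; apply/mapP.
    by exists z; rewrite ?xE ?tgt_opp ?yw // mem_cat mem_rcons mem_head.
  - have [w _ [_ [zy _]]] := (walk_cat _ _ _ _).1 sv.
    have zE : z = opp y.
      by apply: add_edge_org zy; apply: sE; rewrite mem_cat !inE eqxx !orbT.
    by have := (cat_sorted2 srt).2; rewrite /= zE eqxx.
have oys : opp y \notin s.
  apply/negP=> /splitPr oys; case: oys sE sv ys {srt un circ} => s1 s2 sE sv ys.
  have notin z : z \in s1 ++ opp y :: s2 -> tgt z <> tgt y.
    by move=> zs /(add_edge_tgtE (sE z zs)) zy; move: zs; rewrite zy (negbTE ys).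
  case/lastP: s1 sE sv ys notin => [|s1 z] sE sv ys notin.
    case: sv; rewrite org_opp => yv; case/lastP: s2 sE ys notin => [|s2 z] sE ys notin.
      by rewrite /= tgt_opp -yv => /loopless.
    by move/walk_rcons; rewrite -yv; apply: notin; rewrite inE mem_rcons mem_head orbT.
  case/walk_cat: sv => w /walk_rcons zw [yw _]; apply: (notin z).
    by rewrite mem_cat mem_rcons mem_head.
  by rewrite zw -yw org_opp.
apply: (acyc s) circ => x xs; case: (sE x xs) => // xE.
  by rewrite -xE xs in ys.
by rewrite -xE xs in oys.
Qed.

Lemma add_edge_subtree : is_subtree add_edge.
Proof.
have [[v0 Tv0] conn _] := T_max.1.
split; [by exists v0; left| |exact: add_edge_acyclic].
have toT u : V' u ->
    exists2 v, sub_vert T v & exists2 s, walk u s v & {in s, forall x, E' x}.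
  case=> [Tu|->]; first by exists u => //; exists [::].
  exists (org y) => //; exists [:: opp y]; first by rewrite /= org_opp tgt_opp.
  by move=> x; rewrite inE => /eqP->; apply: Or33.
move=> u v /toT[u' Tu' [s us sE]] /toT[v' Tv' [s' vs s'E]].
have [m um mT] := conn _ _ Tu' Tv'.
exists (s ++ m ++ rev (map (@opp X) s')).
  apply/walk_cat; exists u' => //; apply/walk_cat; exists v' => //.
  exact: walk_rev.
move=> x; rewrite !mem_cat mem_rev => /or3P[/sE//|/mT|/mapP[z /s'E zE ->]].
  exact: Or31.
exact: add_edge_opp.
Qed.

End AddEdge.

Lemma maximal_subtree_spans v : sub_vert T v.
Proof.
apply: contrapT => nTv; have [[u Tu] _ _] := T_max.1.
have [s us] := X_conn u v.
have [y [Ty nTy]] := exit_edge us Tu nTv.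
have [sub _] := T_max.2 _ (add_edge_subtree Ty nTy)
  (fun w => @or_introl _ _) (fun e => @Or31 _ _ _).
by apply/nTy/sub; right.
Qed.

Lemma tree_walk u v : exists2 s, walk u s v & {in s, forall y, sub_edge T y}.
Proof. by have [_ conn _] := T_max.1; apply: conn; apply: maximal_subtree_spans. Qed.

(** [t v] is the value of a walk in the tree from a base point to [v]. *)
Lemma tree_potential (Q : groupType) (c : edge X -> Q) :
    (forall y, c (opp y) = (c y)^-1) ->
  exists t : vert X -> Q, forall y, sub_edge T y -> t (tgt y) = t (org y) * c y.
Proof.
move=> cV; have [[v0 _] _ acyc] := T_max.1.
have /choice[s sP] v : exists s, walk v0 s v /\ {in s, forall y, sub_edge T y}.
  by have [s ? ?] := tree_walk v0 v; exists s.
exists (fun v => walk_val c (s v)) => y Ty.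
have [wo To] := sP (org y); have [wt Tt] := sP (tgt y).
pose loop := s (org y) ++ y :: rev (map (@opp X) (s (tgt y))).
have : walk_val c loop = 1.
  apply: (closed_walk_val1 cV acyc (v := v0)).
    move=> x; rewrite mem_cat inE mem_rev => /or3P[/To//|/eqP->//|/mapP[z /Tt Tz ->]].
    exact: sub_opp.
  by apply/walk_cat; exists (org y) => //; split=> //; apply: walk_rev.
rewrite walk_val_cat /= walk_val_rev // mulgA => /divg1_eq.
by move->.
Qed.

End MaximalTree.

(** * Change of gauge *)

Section Gauge.
Variables (X : graph) (G : graph_of_fingroups X) (Q : groupType) (r : rep G Q).
Variable t : vert X -> Q.

Definition gauge_vert v (g : vgrp G v) := t v * rvert r g * (t v)^-1.
Definition gauge_edge (y : edge X) := t (org y) * redge r y * (t (tgt y))^-1.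

Fact gauge_vertM v : {morph @gauge_vert v : g h / g * h}.
Proof. by move=> g h; rewrite /gauge_vert rvertM !mulgA mulgVK. Qed.

Fact gauge_edgeV y : gauge_edge (opp y) = (gauge_edge y)^-1.
Proof. by rewrite /gauge_edge redgeV !invgM invgK org_opp tgt_opp mulgA. Qed.

Fact gauge_edgeC y e (ye : to_uedge y = e) (oye : to_uedge (opp y) = e) g :
  gauge_edge y * gauge_vert (incl ye g) = gauge_vert (incl oye g) * gauge_edge y.
Proof.
rewrite /gauge_edge /gauge_vert -(tgt_opp y) !mulgA !mulgVK.
by rewrite -[_ * redge r y * _]mulgA (redgeC r ye oye) !mulgA.
Qed.

Definition gauge := Rep gauge_vertM gauge_edgeV gauge_edgeC.

Lemma path_val_gauge u s w : walk u (map tag s) w ->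
  path_val gauge s = t u * path_val r s * (t w)^-1.
Proof.
elim: s u => [|l s IH] u /=; first by move->; rewrite mulg1 mulgV.
case=> <- /IH->; rewrite /gauge_edge /gauge_vert !mulgA !mulgVK.
by [].
Qed.

End Gauge.

(** * The fundamental group *)

Section Pi1.
Variables (X : graph) (G : graph_of_fingroups X) (T : subgraph X).
Variable Eplus : set (edge X).
Hypothesis Eplus_or : is_orientation Eplus.

Local Notation pi := (pi1 G T Eplus).
Local Notation cls := (pres_class (pi1_rel (G := G) T Eplus)).

Lemma pi1_cls u v : pi1_rel T Eplus u v -> cls u = cls v.
Proof. by move=> uv; apply/pres_classP/cong_rel. Qed.

Lemma cls_cat u v : cls (u ++ v) = cls u * cls v :> pi.
Proof. by rewrite [RHS]pres_mulE. Qed.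

Lemma cls_inv (x : pi1_gen G) : cls [:: (x, true)] = (cls [:: (x, false)])^-1 :> pi.
Proof.
apply: (mulgI (cls [:: (x, false)] : pi)); rewrite mulgV -cls_cat.
exact/pres_classP/(cong_cancel _ x false).
Qed.

(** The relation of a positive edge expresses the edge group by the vertex group
    at the end conjugated by the edge letter; that of a negative edge simply
    identifies it with a subgroup of the vertex group. *)
Lemma elet_edge y (g : egrp G (to_uedge y)) :
  cls [:: elet g] = if `[< Eplus y >]
    then cls [:: stab G y] * cls [:: vlet (emor G y g)] * (cls [:: stab G y])^-1
    else cls [:: vlet (emor G y g)] :> pi.
Proof.
rewrite (pi1_cls (pi1_edge T Eplus g)) /epsilon; case: asboolP => _ //=.
by rewrite -cls_inv -!cls_cat.
Qed.

Lemma pi1_rep : exists rho : rep G pi,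
  (forall v (g : vgrp G v), rvert rho g = cls [:: vlet g]) /\
  (forall y, Eplus y -> redge rho y = cls [:: stab G y]).
Proof.
have vM v : {morph (fun g : vgrp G v => cls [:: vlet g] : pi) : g h / g * h}.
  by move=> g h; rewrite -cls_cat (pi1_cls (pi1_vmul T Eplus g h)).
have [y Ey e ye oye g|rho rhoV rhoE] :=
  @rep_of_oriented X G pi Eplus _ (fun y => cls [:: stab G y]) Eplus_or vM.
  have Eoy : ~ Eplus (opp y) by case: (Eplus_or y) => -[].
  have <- : cls [:: elet g] = cls [:: vlet (incl oye g)] :> pi.
    by case: e / oye {ye} g => g; rewrite elet_edge; case: asboolP.
  case: e / ye {oye} g => g; rewrite elet_edge; case: asboolP => // _.
  by rewrite mulgVK.
by exists rho; split=> // v g; rewrite rhoV.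
Qed.

Variable rho : rep G pi.
Hypothesis rhoV : forall v (g : vgrp G v), rvert rho g = cls [:: vlet g].
Hypothesis rhoE : forall y, Eplus y -> redge rho y = cls [:: stab G y].

Lemma pi1_tree1 y : sub_edge T y -> redge rho y = 1.
Proof.
have pos z : Eplus z -> sub_edge T z -> redge rho z = 1.
  by move=> /rhoE-> /(pi1_tree G Eplus)/pi1_cls.
move=> Ty; case: (Eplus_or y) => -[Ey Eoy]; first exact: pos.
by rewrite -[y]oppK redgeV pos ?invg1 //; apply: sub_opp.
Qed.

(** The letters of the edge groups, the letters of negative edges and all
    inverse letters are redundant. *)
Lemma pi1_ind (P : pi -> Prop) : P 1 ->
    (forall v (g : vgrp G v) x, P x -> P (rvert rho g * x)) ->
    (forall y x, P x -> P (redge rho y * x)) ->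
  forall x, P x.
Proof.
move=> P1 PV PE x; rewrite -[x]pres_classK.
have PE' y z : P z -> P ((redge rho y)^-1 * z) by rewrite -redgeV; apply: PE.
have PV' v (g : vgrp G v) z : P z -> P ((rvert rho g)^-1 * z).
  by rewrite -rvertV; apply: PV.
have Ps y z : P z -> P (cls [:: stab G y] * z) /\ P ((cls [:: stab G y])^-1 * z).
  move=> Pz; case: (Eplus_or y) => -[Ey Eoy].
    by rewrite -rhoE //; split; [exact: PE | exact: PE'].
  rewrite -(pi1_cls (pi1_opp G T Eplus y)) -rhoE //.
  by split; [exact: PE | exact: PE'].
elim: {x} (generic_quotient.repr x) => [//|[s b] u IH].
rewrite -cat1s cls_cat; case: s => [[[v g]|[e g]]|y].
- by case: b; rewrite ?cls_inv -/(vlet g) -rhoV; [exact: PV' | exact: PV].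
- have [y ye] : exists y, to_uedge y = e.
    by exists (generic_quotient.repr e); rewrite /to_uedge reprK.
  case: e / ye g => g; case: b; rewrite ?cls_inv -/(elet g) elet_edge -rhoV;
    case: asboolP => _; rewrite ?invgM ?invgK -?mulgA.
  + by apply: (Ps y _ _).1; apply: PV'; apply: (Ps y _ _).2.
  + exact: PV'.
  + by apply: (Ps y _ _).1; apply: PV; apply: (Ps y _ _).2.
  + exact: PV.
- by case: b; rewrite ?cls_inv -/(stab G y); [apply: (Ps y _ _).2 | apply: (Ps y _ _).1].
Qed.

(** An edge group has to be sent to [Q] through one of the two orientations of
    its edge; by the conjugation relation [ev] does not depend on which. *)
Lemma pi1_lift (Q : groupType) (r : rep G Q) :
    (forall y, sub_edge T y -> redge r y = 1) ->
  exists f : {multiplicative pi -> Q},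
    (forall v (g : vgrp G v), f (rvert rho g) = rvert r g) /\
    (forall y, f (redge rho y) = redge r y).
Proof.
move=> rT.
pose ev y e (ye : to_uedge y = e) g :=
  if `[< Eplus y >] then redge r y * rvert r (incl ye g) * (redge r y)^-1
  else rvert r (incl ye g).
have evE y z e (ye : to_uedge y = e) (ze : to_uedge z = e) g :
    ev y e ye g = ev z e ze g.
  have : same_uedge y z.
    by have /eqmodP : to_uedge y = to_uedge z by rewrite ye ze.
  case/orP=> /eqP zy; subst z; first by rewrite (eq_irrelevance ye ze).
  rewrite /ev; case: (Eplus_or y) => -[/asboolP + /asboolP]; rewrite asbool_neg.
    by move=> -> /negbTE->; rewrite (redgeC r ye ze) mulgK.
  by move=> /negbTE-> ->; rewrite redgeV invgK -mulgA -(redgeC r ye ze) mulKg.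
pose es y := if `[< Eplus y >] then redge r y else redge r (opp y).
pose rp (e : uedge X) : to_uedge (generic_quotient.repr e) = e := reprK e.
pose F (x : pi1_gen G) : Q := match x with
  | inl (inl vg) => rvert r (tagged vg)
  | inl (inr eg) => ev _ _ (rp (tag eg)) (tagged eg)
  | inr y => es y
  end.
have [u v|f fE] := @presented_lift _ (pi1_rel (G := G) T Eplus) Q F.
  case=> {u v} [v g h|e g h|y g|y Ty|y] /=; rewrite ?mulg1.
  - by rewrite rvertM.
  - rewrite /ev inclM rvertM; case: asboolP => _ //.
    by rewrite !mulgA mulgVK.
  - rewrite (evE _ y _ _ erefl) /ev /epsilon /=; case: asboolP => Ey /=; rewrite mulg1 //.
    by rewrite /es; case: asboolP => // _; rewrite mulgA.
  - by rewrite /es; case: asboolP => _; apply: rT => //; apply: sub_opp.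
  - rewrite /es; case: (Eplus_or y) => -[/asboolP + /asboolP]; rewrite asbool_neg.
      by move=> -> /negbTE->; rewrite oppK.
    by move=> /negbTE-> ->.
exists f; split=> [v g|y]; first by rewrite rhoV fE /= mulg1.
have pos z : Eplus z -> f (redge rho z) = redge r z.
  by move=> Ez; rewrite rhoE // fE /= mulg1 /es asboolT.
case: (Eplus_or y) => -[Ey Eoy]; first exact: pos.
apply: (mulgI (redge r (opp y))); rewrite -{1}pos // -gmulfM.
by rewrite !redgeV !mulVg (morph_fun1 (@gmulfM _ _ f)).
Qed.

Definition path_from (w v : vert X) (x : pi) : Prop :=
  exists (g : vgrp G v) (s : seq (pstep G)),
    [/\ walk v (map tag s) w, reduced s & x = rvert rho g * path_val rho s].

(** Prepending an edge keeps the path reduced, except when it creates a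
    backtracking [y (emor y a) (opp y)]; this is replaced by the image of [a]
    in the vertex group at the origin of [y]. *)
Lemma path_from_edge w y x :
  path_from w (tgt y) x -> path_from w (org y) (redge rho y * x).
Proof.
rewrite -[org y]tgt_opp => -[g [s [ws red ->]]].
have cons : (forall l s', s = l :: s' -> tag l = opp y -> forall a, g <> emor G y a) ->
    path_from w (tgt (opp y)) (redge rho y * (rvert rho g * path_val rho s)).
  move=> nback; exists 1, (Tagged (fun y => vgrp G (tgt y)) g :: s); split.
  - by rewrite /= tgt_opp.
  - by split=> //; case: s {ws red} nback => // l s /(_ _ _ erefl).
  - by rewrite rvert1 mul1g /= !mulgA.
case: s ws red cons => [|[z h] s] ws red cons; first exact: cons.
have [zy|nzy] := eqVneq z (opp y); last first.
  by apply: cons => l s' [<- _] /= zy; rewrite zy eqxx in nzy.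
have [[a ga]|nga] := pselect (exists a, g = emor G y a); last first.
  by apply: cons => l s' _ _ a ga; apply: nga; exists a.
case: ws => _ ws; case: red => _ red; subst z.
have ye := to_uedge_opp y.
exists (incl ye a * h), s; split=> //.
have /= C := redgeC rho erefl ye a.
by rewrite /= rvertM ga !mulgA C redgeV mulgK.
Qed.

Hypotheses (X_conn : graph_connected X) (T_max : is_maximal_subtree T).

(** The edges of the tree are trivial in [pi1], so the starting point of a path
    can be moved along the tree. *)
Lemma path_from_tree w u v x : path_from w u x -> path_from w v x.
Proof.
have [s vs sT] := tree_walk X_conn T_max v u => ux.
elim: s v vs sT => [|y s IH] v /=; first by move->.
case=> <- ys sT; rewrite -[x]mul1g -(@pi1_tree1 y); last exact/sT/mem_head.
by apply/path_from_edge/IH => // z zs; apply: sT; rewrite inE zs orbT.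
Qed.

(** A generator attached to [v] is multiplied to the path after moving its
    starting point from [w] to [v], and then back. *)
Lemma pi1_path w x : path_from w w x.
Proof.
elim/pi1_ind: x => [|v g x /(@path_from_tree w w v) wx
                    |y x /(@path_from_tree w w (tgt y)) wx].
- by exists 1, [::]; rewrite /= rvert1 mulg1.
- apply: (@path_from_tree w v); have [h [s [ws red ->]]] := wx.
  by exists (g * h), s; rewrite rvertM mulgA.
- exact: path_from_tree (path_from_edge wx).
Qed.

End Pi1.

Theorem theorem4 (p : nat) (p_pr : prime p)
    (X : graph) (X_conn : graph_connected X)
    (G : graph_of_fingroups X) (G_p : graph_of_pgroups G p)
    (T : subgraph X) (T_max : is_maximal_subtree T)
    (Eplus : set (edge X)) (Eplus_or : is_orientation Eplus)
    (CV : forall v : vert X, nat -> {group vgrp G v})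
    (CE : forall e : uedge X, nat -> {group egrp G e})
    (CV_chief : forall v, chief_series p (CV v))
    (CE_chief : forall e, chief_series p (CE e))
    (hI : forall (k : nat) (y : edge X),
        emor G y @* CE (to_uedge y) k
          = (emor G y @* [set: egrp G (to_uedge y)]) :&: CV (tgt y) k)
    (hII : forall k : nat,
        exists (phiV : forall v, {morphism (CV v k / CV v k.+1) >-> 'F_p})
               (phiE : forall e, {morphism (CE e k / CE e k.+1) >-> 'F_p}),
          [/\ forall v, 'injm (phiV v),
              forall e, 'injm (phiE e)
            & forall y : edge X,
                {in CE (to_uedge y) k / CE (to_uedge y) k.+1,
                   phiV (tgt y) \o induced (emor G y) (CV (tgt y) k.+1)
                     =1 phiE (to_uedge y)}]) :
  residually_p_finite p (pi1 G T Eplus).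
Proof.
move=> x x1; have [[v0 _] _ _] := T_max.1.
have [rho [rhoV rhoE]] := @pi1_rep X G T Eplus Eplus_or.
have [g [s [ws red xE]]] := pi1_path Eplus_or rhoV rhoE X_conn T_max v0 x.
have /choice[n nP] v : exists n, forall k, n <= k -> CV v k :=: 1.
  exact: chief_vanish (CV_chief v).
pose vs := v0 :: map (@tgt X \o tag) s; pose k := \max_(v <- vs) n v.
have Ck v : v \in vs -> CV v k :=: 1 by move=> vvs; apply/nP/leq_bigmax_seq.
(* [k] is large enough for the vertex groups that occur on the path. *)
have [Q [r [pQ rK]]] := rep_of_chief p_pr G_p CV_chief CE_chief hI hII Eplus_or k.
have r_inj v : v \in vs -> injective (@rvert _ _ _ r v).
  move=> vvs a b ab; apply/divg1_eq/set1gP; rewrite -(Ck v vvs); apply/rK.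
  by rewrite rvertM rvertV ab mulgV.
have [l ls|Q' [r' [pQ' inj' esc]]] := @reduced_escapes X G p Q r s p_pr pQ red.
  by apply: r_inj; rewrite inE; apply/orP; right; apply/mapP; exists l.
have [t tE] := tree_potential X_conn T_max (redgeV r').
have [y Ty|f [fV fE]] := @pi1_lift X G T Eplus Eplus_or rho rhoV rhoE Q' (gauge r' t).
  by rewrite /= /gauge_edge tE // mulgV.
exists Q', f; split=> // fx1.
have fpath u : f (path_val rho u) = path_val (gauge r' t) u.
  elim: u => [|l u IH] /=; last by rewrite !gmulfM fV fE IH.
  exact/morph_fun1/gmulfM.
have : rvert r' g * path_val r' s = 1.
  apply: (conjg_inj (t v0)^-1); rewrite conj1g -fx1 xE gmulfM fV fpath (path_val_gauge _ _ ws).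
  by rewrite /= /gauge_vert conjgE invgK !mulgA mulgVK.
move=> gs1; have inj0 := inj' v0 (r_inj v0 (mem_head _ _)).
case/lastP: s esc gs1 xE {ws red vs k Ck rK r_inj inj'} => [|s l] esc gs1 xE.
  case: x1; rewrite xE /= mulg1; move: gs1; rewrite /= mulg1 -(rvert1 r' v0).
  by move/inj0->; rewrite rvert1.
apply: (esc s l [::] _ v0 g^-1); first by rewrite cats1.
by rewrite rvertV; apply: (mulgI (rvert r' g)); rewrite gs1 mulgV.
Qed.
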